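(* Let $L>0$, let $N\ge1$ be an integer, and let $h\in(0,1]$. Define $$\psi_N(c):=1-\sum_{i=0}^{N-1}\frac{(c-1)(2Nc-2N+1)(2Nc+1)}{2Nc+4Nci-2i^2+1}$$ and let $c_{\mathrm{crit}}$ be the largest (real) root of $\psi_N$. Let $c\in[1,c_{\mathrm{crit}}]$. Then for any convex $L$-smooth function $f$ with minimizer $x_\star$ and any $x_0$, if $x_1,\dots,x_N$ are produced by gradient descent with constant stepsizes $h_k=h$, the point $x_\sigma=x_0+c(x_N-x_0)$ satisfies $$f(x_\sigma)-f(x_\star)\le\frac{LD^2}{4Nhc+2},\qquad D=\|x_0-x_\star\|.$$ Moreover, for any $L,D>0$, there exists a convex $L$-smooth function $f$ with minimizer $x_\star$ (and an $x_0$ with $\|x_0-x_\star\|=D$) for which equality holds.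
   Context: Functions are $f:\mathbb R^d\to\mathbb R$ ($d\ge1$), with the Euclidean norm; $f$ is $L$-smooth if it is differentiable with $L$-Lipschitz gradient. Gradient descent from $x_0$ with stepsizes $h_k$ is $x_{k+1}=x_k-\frac{h_k}{L}\nabla f(x_k)$, $k=0,\dots,N-1$. *)

(* Defs.v *)
From HB Require Import structures.
From mathcomp Require Import all_boot all_order all_algebra.
From mathcomp Require Import all_classical all_reals all_analysis.
Set Implicit Arguments.
Unset Strict Implicit.
Unset Printing Implicit Defensive.
Import Order.TTheory GRing.Theory Num.Theory.
Import numFieldNormedType.Exports.
Local Open Scope classical_set_scope.
Local Open Scope ring_scope.

(* The library norm `|u| on row vectors is the sup norm, hence this definition.
   In finite dimension both norms give the same notion of differentiability. *)
Definition enorm (R : realType) (d : nat) (u : 'rV[R]_d) : R :=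
  Num.sqrt (\sum_(i < d) u 0 i ^+ 2).

Definition gradient (R : realType) (d : nat) (f : 'rV[R]_d -> R^o)
    (x : 'rV[R]_d) : 'rV[R]_d :=
  \row_(i < d) 'D_(delta_mx 0 i) f x.

Definition smooth (R : realType) (d : nat) (L : R) (f : 'rV[R]_d -> R^o) : Prop :=
  (forall x, differentiable f x) /\
  (forall x y, enorm (gradient f x - gradient f y) <= L * enorm (x - y)).

Definition convex (R : realType) (d : nat) (f : 'rV[R]_d -> R^o) : Prop :=
  @convex_function R 'rV[R]_d setT f.

Definition minimizer (R : realType) (d : nat) (f : 'rV[R]_d -> R^o)
    (xs : 'rV[R]_d) : Prop :=
  forall x, f xs <= f x.

Fixpoint gd (R : realType) (d : nat) (L : R) (h : nat -> R)
    (f : 'rV[R]_d -> R^o) (x0 : 'rV[R]_d) (k : nat) : 'rV[R]_d :=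
  if k is k'.+1 then
    let x := gd L h f x0 k' in x - (h k' / L) *: gradient f x
  else x0.

Definition psi_den (R : realType) (N i : nat) (c : R) : R :=
  2 * N%:R * c + 4 * N%:R * c * i%:R - 2 * i%:R ^+ 2 + 1.

Definition psi (R : realType) (N : nat) (c : R) : R :=
  1 - \sum_(0 <= i < N)
        (c - 1) * (2 * N%:R * c - 2 * N%:R + 1) * (2 * N%:R * c + 1)
          / psi_den N i c.

(* Division is total (x / 0 = 0), so the poles of psi are excluded explicitly. *)
Definition psi_root (R : realType) (N : nat) (c : R) : Prop :=
  (forall i, (i < N)%N -> psi_den N i c != 0) /\ psi N c = 0.

Definition psi_largest_root (R : realType) (N : nat) (ccrit : R) : Prop :=
  psi_root N ccrit /\ forall c, psi_root N c -> c <= ccrit.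

(* Main.v *)
(* Normalise L = 1 and write [g_0, ..., g_N] for the gradients at
   x_0, ..., x_(N-1) and x_sigma; the iterate x_N itself plays no role. The
   upper bound is a weighted sum of interpolation inequalities: with
   K = 2Nc + 1 and alpha_m = c m / (K - m), weight alpha_m is put on the pair
   (m-1, m) and weight q_m = alpha_(m+1) - alpha_m (and 1 - alpha_N for m = N) on
   the pair (x_star, m). Young's inequality in x_0 - x_star leaves a quadratic
   form in the g_m which is affine in h. At h = 0 it is Jensen's inequality. At
   h = 1 it is invariant under translations of g, and on u_m = g_m - g_N it is a
   Sturm-Liouville form in the partial sums U_m of u, minus the square of a
   linear form. The Jacobi equation of the first part has the solution
   r_m = K - m, so U_m = r_m w_m turns it into a sum of squares of the increments
   of w plus a boundary term; the denominators of psi_N appear as the weights, and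
   psi_N(c) >= 0 is exactly the Cauchy-Schwarz condition for it to dominate the
   square. On [1, oo) each summand of psi_N is monotone, so psi_N >= 0 holds on
   [1, c_crit]. Equality is attained by a Huber function of one coordinate. *)
Require Import Defs.
From mathcomp Require Import all_boot all_order all_algebra.
From mathcomp Require Import all_classical all_reals all_analysis.
From mathcomp Require Import ring lra.
Set Implicit Arguments.
Unset Strict Implicit.
Unset Printing Implicit Defensive.
Import Order.TTheory GRing.Theory Num.Theory.
Import numFieldNormedType.Exports.
Local Open Scope ring_scope.

(** * The dual certificate *)

(** The multiplier alpha_m; for m < N the multiplier q_m is the increment from m to m + 1. *)
Definition chain_wt (R : realFieldType) (K c : R) (m : nat) : R :=
  c * m%:R / (K - m%:R).

(** Up to the factor c, the numerator of alpha_i + alpha_(i+1) over the common denominator (K - i)(K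
    - i - 1). At K = 2Nc + 1 it is the denominator of the i-th summand of psi_N. *)
Definition pivot (R : realFieldType) (K : R) (i : nat) : R :=
  i%:R * (K - i%:R - 1) + (i%:R + 1) * (K - i%:R).

Definition psum (R : realFieldType) (u : nat -> R) (n : nat) : R :=
  \sum_(0 <= k < n) u k.

Lemma psum0 (R : realFieldType) (u : nat -> R) : psum u 0 = 0.
Proof. by rewrite /psum big_geq. Qed.

Lemma psumS (R : realFieldType) (u : nat -> R) n :
  psum u n.+1 = psum u n + u n.
Proof. by rewrite /psum big_nat_recr. Qed.

Lemma chain_wt0 (R : realFieldType) (K c : R) : chain_wt K c 0 = 0.
Proof. by rewrite /chain_wt mulr0 mul0r. Qed.

Lemma chain_gap_neq0 (R : realFieldType) (K : R) n :
  n.+1%:R < K -> (K - n%:R != 0) /\ (K - (n%:R + 1) != 0).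
Proof.
rewrite -addn1 natrD => hK; split; apply/eqP => h; first by lra.
lra.
Qed.

Lemma ltr_natS (R : realFieldType) (K : R) n : n.+1%:R < K -> n%:R < K.
Proof. by apply: le_lt_trans; rewrite ler_nat. Qed.

(** With [psum u i] = (K - i) w_i, the increments of w diagonalise the form up to a boundary term in
    w_n. Each induction step is a rational identity whose poles are excluded by n + 1 < K. *)
Lemma sturm_liouville (R : realFieldType) (K c : R) (u : nat -> R) n :
  n%:R < K ->
  \sum_(0 <= i < n) ((chain_wt K c i + chain_wt K c i.+1) * u i ^+ 2 +
     (chain_wt K c i.+1 - chain_wt K c i) *
       (psum u i.+1 ^+ 2 - psum u i ^+ 2)) =
  \sum_(0 <= i < n) c * pivot K i *
     (psum u i.+1 / (K - i.+1%:R) - psum u i / (K - i%:R)) ^+ 2 +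
  c * (K - 2 * n%:R) * (psum u n / (K - n%:R)) ^+ 2.
Proof.
elim: n => [|n IH] hK; first by rewrite !big_geq // psum0; ring.
have [h1 h2] := chain_gap_neq0 hK; have {IH} IH := IH (ltr_natS hK).
rewrite !big_nat_recr //= IH psumS /chain_wt /pivot.
by rewrite -(addn1 n) natrD; field; rewrite h1 h2.
Qed.

(** Summation by parts puts the linear form into the coordinates of [sturm_liouville], so that
    Cauchy-Schwarz can compare the two. *)
Lemma sum_gap_mul (R : realFieldType) (K c : R) (u : nat -> R) n :
  n%:R < K ->
  \sum_(0 <= i < n) (chain_wt K c i.+1 - chain_wt K c i) * u i =
  \sum_(0 <= i < n) (chain_wt K c i + chain_wt K c i.+1) *
     (psum u i.+1 / (K - i.+1%:R) - psum u i / (K - i%:R)) +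
  (c - chain_wt K c n) * (psum u n / (K - n%:R)).
Proof.
elim: n => [|n IH] hK; first by rewrite !big_geq // psum0; ring.
have [h1 h2] := chain_gap_neq0 hK; have {IH} IH := IH (ltr_natS hK).
rewrite !big_nat_recr //= IH psumS /chain_wt.
by rewrite -(addn1 n) natrD; field; rewrite h1 h2.
Qed.

(** The summand is 1/(K - i - 1) - 1/(K - i). *)
Lemma sum_inv_gap (R : realFieldType) (K : R) n : n%:R < K ->
  \sum_(0 <= i < n) ((K - i%:R) * (K - i.+1%:R))^-1 = n%:R / (K * (K - n%:R)).
Proof.
elim: n => [|n IH] hK; first by rewrite big_geq // mul0r.
have [h1 h2] := chain_gap_neq0 hK; have {IH} IH := IH (ltr_natS hK).
rewrite big_nat_recr //= IH.
have K0 : K != 0 by rewrite gt_eqF // (le_lt_trans _ hK).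
by rewrite -(addn1 n) natrD; field; rewrite h1 h2 K0.
Qed.

(** Telescopes: alpha_(i+1) - alpha_i = c K / ((K - i)(K - i - 1)), so each summand is an increment
    of alpha_i^2 / (c K) = c i^2 / (K (K - i)^2). *)
Lemma sum_wt_gap (R : realFieldType) (K c : R) n : n%:R < K ->
  \sum_(0 <= i < n) (chain_wt K c i + chain_wt K c i.+1) /
     ((K - i%:R) * (K - i.+1%:R)) = c * n%:R ^+ 2 / (K * (K - n%:R) ^+ 2).
Proof.
elim: n => [|n IH] hK; first by rewrite big_geq // expr0n /= mulr0 mul0r.
have [h1 h2] := chain_gap_neq0 hK; have {IH} IH := IH (ltr_natS hK).
rewrite big_nat_recr //= IH /chain_wt.
have K0 : K != 0 by rewrite gt_eqF // (le_lt_trans _ hK).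
by rewrite -(addn1 n) natrD; field; rewrite h1 h2 K0.
Qed.

Lemma psum_shift (R : realFieldType) (g : nat -> R) (e : R) n :
  psum g n = psum (fun i => g i - e) n + n%:R * e.
Proof.
elim: n => [|n IH]; first by rewrite !psum0; ring.
by rewrite !psumS IH -(addn1 n) natrD; ring.
Qed.

(** Meant for e = g_N and n = N. When K = 2Nc + 1 the coefficient of e^2 is K - 1, so after adding
    e^2 the terms in e complete a square with leading coefficient K. *)
Lemma quadratic_shift (R : realFieldType) (K c e : R) (g : nat -> R) n :
  n%:R < K ->
  let u i := g i - e in
  \sum_(0 <= i < n) ((chain_wt K c i + chain_wt K c i.+1) * g i ^+ 2 +
     (chain_wt K c i.+1 - chain_wt K c i) *
       (psum g i.+1 ^+ 2 - psum g i ^+ 2)) +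
  2 * (c - chain_wt K c n) * (e * psum g n) =
  \sum_(0 <= i < n) ((chain_wt K c i + chain_wt K c i.+1) * u i ^+ 2 +
     (chain_wt K c i.+1 - chain_wt K c i) *
       (psum u i.+1 ^+ 2 - psum u i ^+ 2)) +
  2 * e * K * (\sum_(0 <= i < n) (chain_wt K c i.+1 - chain_wt K c i) * u i) +
  e ^+ 2 * (K * chain_wt K c n + (c - chain_wt K c n) * n%:R).
Proof.
move=> hK u.
(* Everything is expressed through u and e, so that only the partial sums of u have to be unfolded
   in the induction. *)
suff <- : \sum_(0 <= i < n)
    ((chain_wt K c i + chain_wt K c i.+1) * (u i + e) ^+ 2 +
     (chain_wt K c i.+1 - chain_wt K c i) *
       ((psum u i.+1 + i.+1%:R * e) ^+ 2 - (psum u i + i%:R * e) ^+ 2)) +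
  2 * (c - chain_wt K c n) * (e * (psum u n + n%:R * e)) =
  \sum_(0 <= i < n) ((chain_wt K c i + chain_wt K c i.+1) * u i ^+ 2 +
     (chain_wt K c i.+1 - chain_wt K c i) *
       (psum u i.+1 ^+ 2 - psum u i ^+ 2)) +
  2 * e * K * (\sum_(0 <= i < n) (chain_wt K c i.+1 - chain_wt K c i) * u i) +
  e ^+ 2 * (K * chain_wt K c n + (c - chain_wt K c n) * n%:R).
  rewrite (psum_shift g e n); congr (_ + _).
  apply: eq_bigr => i _; rewrite (psum_shift g e i) (psum_shift g e i.+1).
  by rewrite subrK.
elim: n hK => [|n IH] hK; first by rewrite !big_geq // psum0 chain_wt0; ring.
have [h1 h2] := chain_gap_neq0 hK; have {IH} IH := IH (ltr_natS hK).
rewrite !big_nat_recr //= !psumS.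
(* The boundary term depends on n, so the induction hypothesis is solved for its first sum before
   substitution. *)
rewrite (canRL (addrK _) IH).
rewrite /chain_wt -(addn1 n) natrD.
by field; rewrite h1 h2.
Qed.

(** The products g_i g_(i+1) cancel, and g_i^2 + 2 g_i U_i is the increment of U^2. Reindexing the
    squares of g_(i+1), with alpha_0 = 0, leaves the last term. *)
Lemma sum_wt_sqr (R : realFieldType) (K c : R) (g : nat -> R) n :
  \sum_(0 <= i < n) ((chain_wt K c i.+1 - chain_wt K c i) * g i ^+ 2 +
     chain_wt K c i.+1 * (g i - g i.+1) ^+ 2 +
     2 * ((chain_wt K c i.+1 - chain_wt K c i) * (g i * psum g i) +
          chain_wt K c i.+1 * (g i.+1 * g i))) =
  \sum_(0 <= i < n) ((chain_wt K c i + chain_wt K c i.+1) * g i ^+ 2 +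
     (chain_wt K c i.+1 - chain_wt K c i) *
       (psum g i.+1 ^+ 2 - psum g i ^+ 2)) + chain_wt K c n * g n ^+ 2.
Proof.
elim: n => [|n IH]; first by rewrite !big_geq // chain_wt0; ring.
by rewrite !big_nat_recr //= IH psumS; ring.
Qed.

(* Cauchy-Schwarz for the form [B d = \sum_i a_i d_i ^+ 2 + s (\sum_i d_i) ^+ 2],
   with [Q = \sum_i a_i d_i ^+ 2] and [p = \sum_i d_i]: the linear form [W] is
   represented in [B] by a vector [b] with [\sum_i b_i = P] and
   [\sum_i a_i b_i ^+ 2 = Y]; the last hypothesis is
   [0 <= \sum_i a_i (d_i - K W b_i) ^+ 2]. *)
Lemma rank_one_dominated (R : realFieldType) (X W p Q Y K s P k q : R) :
  W = X + k * p -> k = q + s * P -> 0 <= s -> 0 <= K ->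
  K * (Y + s * P ^+ 2) <= 1 ->
  0 <= Q - 2 * (K * W) * (X + q * p) + (K * W) ^+ 2 * Y ->
  K * W ^+ 2 <= Q + s * p ^+ 2.
Proof.
move=> eW ek s0 K0 hY hQ.
have h1 : 0 <= s * (p - K * P * W) ^+ 2 by rewrite mulr_ge0 ?sqr_ge0.
have h2 : 0 <= K * W ^+ 2 * (1 - K * (Y + s * P ^+ 2)).
  by apply: mulr_ge0; [apply: mulr_ge0 => //; exact: sqr_ge0 | rewrite subr_ge0].
have eX : X = W - (q + s * P) * p by rewrite eW ek; ring.
rewrite eX in hQ.
rewrite -subr_ge0.
have -> : Q + s * p ^+ 2 - K * W ^+ 2 =
  (Q - 2 * (K * W) * (W - (q + s * P) * p + q * p) + (K * W) ^+ 2 * Y) +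
  s * (p - K * P * W) ^+ 2 + K * W ^+ 2 * (1 - K * (Y + s * P ^+ 2)) by ring.
by do 2?apply: addr_ge0.
Qed.

Lemma sum_square_shift (R : realFieldType) (a b d : nat -> R) (t : R) n :
  \sum_(0 <= i < n) a i * (d i - t * b i) ^+ 2 =
  \sum_(0 <= i < n) a i * d i ^+ 2 - 2 * t * \sum_(0 <= i < n) a i * b i * d i
    + t ^+ 2 * \sum_(0 <= i < n) a i * b i ^+ 2.
Proof.
elim: n => [|n IH]; first by rewrite !big_geq //; ring.
by rewrite !big_nat_recr //= IH; ring.
Qed.

Lemma pivot_gt0 (R : realFieldType) (K : R) i : i.+1%:R < K -> 0 < pivot K i.
Proof.
move=> hK; have i0 : 0 <= i%:R :> R by [].
rewrite /pivot; rewrite -addn1 natrD in hK.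
have h1 : 0 <= i%:R * (K - i%:R - 1) by apply: mulr_ge0 => //; lra.
have h2 : 0 < (i%:R + 1) * (K - i%:R) by apply: mulr_gt0; lra.
by apply: ltr_wpDl.
Qed.

Lemma chain_pivot (R : realFieldType) (K c : R) i : i.+1%:R < K ->
  chain_wt K c i + chain_wt K c i.+1 =
  c * pivot K i / ((K - i%:R) * (K - i.+1%:R)).
Proof.
move=> hK; have [h1 h2] := chain_gap_neq0 hK.
by rewrite /chain_wt /pivot -(addn1 i) natrD; field; rewrite h1 h2.
Qed.

(** The case h = 1 after translation by g_N; the last hypothesis says psi_N(c) >= 0. In the
    increments d_i of w the right-hand side is diagonal plus s w_N^2, and [rank_one_dominated]
    applies. *)
Lemma chain_dominates_rank_one (R : realFieldType) (K c : R) (u : nat -> R) N :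
  (0 < N)%N -> 1 <= c -> K = 2 * N%:R * c + 1 ->
  (c - 1) * (K - 2 * N%:R) * K * \sum_(0 <= i < N) (pivot K i)^-1 <= 1 ->
  K * (\sum_(0 <= i < N) (chain_wt K c i.+1 - chain_wt K c i) * u i) ^+ 2 <=
  \sum_(0 <= i < N) ((chain_wt K c i + chain_wt K c i.+1) * u i ^+ 2 +
     (chain_wt K c i.+1 - chain_wt K c i) *
       (psum u i.+1 ^+ 2 - psum u i ^+ 2)).
Proof.
move=> N0 c1 eK hpsi.
have Nc : N%:R <= N%:R * c by rewrite ler_peMr.
have N1 : 1 <= N%:R :> R by rewrite ler1n.
have hK : N%:R < K by rewrite eK; nra.
have K0 : 0 < K by apply: le_lt_trans hK.
have c0 : 0 < c by lra.
have iK i : (i < N)%N -> i.+1%:R < K.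
  by move=> iN; apply: le_lt_trans hK; rewrite ler_nat.
rewrite sturm_liouville // sum_gap_mul //.
set w := psum u N / (K - N%:R).
set d := fun i => psum u i.+1 / (K - i.+1%:R) - psum u i / (K - i%:R).
set A := \sum_(0 <= i < N) (pivot K i)^-1 in hpsi *.
have A0 : 0 <= A.
  rewrite /A big_nat; apply: sumr_ge0 => i /andP[_ iN].
  by rewrite invr_ge0 ltW // pivot_gt0 // iK.
pose s := c * (K - 2 * N%:R).
have s0 : 0 < s by rewrite /s mulr_gt0 // eK; lra.
pose k := c - chain_wt K c N.
have sA0 : 0 < c + s * A by rewrite ltr_wpDr // mulr_ge0 // ltW.
(* The representer b must satisfy a_i b_i + s P = D_i + k with P the sum of the b_i. Setting q = k -
   s P and summing b_i = (D_i + q) / a_i gives an equation for q; since k = s / (K - N), its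
   solution is this value. *)
pose q := c * s / (K * (c + s * A)).
pose P := (k - q) / s.
pose a i := c * pivot K i.
pose b i := ((K - i%:R) * (K - i.+1%:R))^-1 + q / (c * pivot K i).
pose D i := chain_wt K c i + chain_wt K c i.+1.
have dw : \sum_(0 <= i < N) d i = w.
  rewrite /d telescope_sumr // /w psum0 mul0r subr0 //.
have ab i : (i < N)%N -> a i * b i = D i + q.
  move=> iN; have hp := pivot_gt0 (iK i iN).
  rewrite /a /b /D chain_pivot ?iK //.
  have [h1 h2] := chain_gap_neq0 (iK i iN).
  rewrite -(addn1 i) natrD.
  by field; rewrite h1 h2 !gt_eqF.
have KN0 : K - N%:R != 0 by rewrite gt_eqF // subr_gt0.
have eY : \sum_(0 <= i < N) a i * b i ^+ 2 =
    c * N%:R ^+ 2 / (K * (K - N%:R) ^+ 2) +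
    2 * q * (N%:R / (K * (K - N%:R))) + q ^+ 2 / c * A.
  rewrite -sum_inv_gap // -sum_wt_gap // /A !big_distrr -!big_split /=.
  rewrite !big_nat; apply: eq_bigr => i /andP[_ iN].
  have hp := pivot_gt0 (iK i iN).
  rewrite chain_pivot ?iK // /a /b.
  have [h1 h2] := chain_gap_neq0 (iK i iN).
  rewrite -(addn1 i) natrD.
  by field; rewrite h1 h2 !gt_eqF.
apply: (@rank_one_dominated _ (\sum_(0 <= i < N) D i * d i) _ w _
  (\sum_(0 <= i < N) a i * b i ^+ 2) K s P k q) => //.
- by rewrite /P; field; rewrite gt_eqF.
- exact: ltW.
- exact: ltW.
(* The hypothesis on psi_N, rewritten using s = (c - 1) K + 1. It says exactly c - 1 <= q. *)
- have hs : (c - 1) * K * (c + s * A) <= c * s.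
    have -> : (c - 1) * K * (c + s * A) =
      c * ((c - 1) * K + (c - 1) * (K - 2 * N%:R) * K * A) by rewrite /s; ring.
    rewrite ler_pM2l //.
    have -> : s = (c - 1) * K + 1 by rewrite /s eK; ring.
    by rewrite lerD2l.
  (* K times the squared dual norm of W collapses to c - q, so the Cauchy-Schwarz condition becomes
     [hs]. *)
  have -> : K * (\sum_(0 <= i < N) a i * b i ^+ 2 + s * P ^+ 2) = c - q.
    rewrite eY /P /q /k /chain_wt.
    have h3 := gt_eqF sA0; have h4 := gt_eqF s0; rewrite /s in h3 h4 *.
    clear - h3 h4 KN0 K0 c0.
    move: (h4); rewrite mulf_eq0 => /norP[_ h5].
    by field; rewrite h3 h5 KN0 !gt_eqF.
  rewrite lerBlDl -lerBlDr /q ler_pdivlMr ?mulr_gt0 //.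
  by rewrite mulrA.
set W := \sum_(0 <= i < N) D i * d i + k * w.
have eab : \sum_(0 <= i < N) a i * b i * d i =
    \sum_(0 <= i < N) D i * d i + q * w.
  rewrite -dw big_distrr -big_split /=.
  rewrite !big_nat; apply: eq_bigr => i /andP[_ iN].
  by rewrite ab // mulrDl.
rewrite -[X in _ <= X]/(\sum_(0 <= i < N) a i * d i ^+ 2 -
  2 * (K * W) * (\sum_(0 <= i < N) D i * d i + q * w) +
  (K * W) ^+ 2 * \sum_(0 <= i < N) a i * b i ^+ 2).
rewrite -eab -sum_square_shift big_nat; apply: sumr_ge0 => i /andP[_ iN].
by rewrite mulr_ge0 ?sqr_ge0 // mulr_ge0 ?ltW // pivot_gt0 // iK.
Qed.

Lemma sum_gap_jensen (R : realFieldType) (K c t : R) (g : nat -> R) n :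
  \sum_(0 <= i < n) (chain_wt K c i.+1 - chain_wt K c i) * (g i - t) ^+ 2 =
  \sum_(0 <= i < n) (chain_wt K c i.+1 - chain_wt K c i) * g i ^+ 2 -
  2 * t * (\sum_(0 <= i < n) (chain_wt K c i.+1 - chain_wt K c i) * g i) +
  t ^+ 2 * chain_wt K c n.
Proof.
elim: n => [|n IH]; first by rewrite !big_geq // chain_wt0; ring.
by rewrite !big_nat_recr //= IH; ring.
Qed.

(** Makes the multipliers q_m, m < N, nonnegative. *)
Lemma chain_wt_homo (R : realFieldType) (K c : R) n :
  0 <= c -> n.+1%:R < K -> chain_wt K c n <= chain_wt K c n.+1.
Proof.
move=> c0 hK; rewrite -subr_ge0.
have [h1 h2] := chain_gap_neq0 hK.
have -> : chain_wt K c n.+1 - chain_wt K c n =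
    c * K / ((K - n%:R) * (K - n.+1%:R)).
  by rewrite /chain_wt -(addn1 n) natrD; field; rewrite h1 h2.
have hn := ltr_natS hK.
by rewrite divr_ge0 // mulr_ge0 // ?subr_ge0 ltW // (le_lt_trans _ hK).
Qed.

(* One coordinate, with [L = 1] and the minimizer at the origin. *)
Lemma extrapolated_certificate (R : realFieldType) (K c h z : R)
    (g y : nat -> R) N :
  (0 < N)%N -> 1 <= c -> 0 < h <= 1 -> K = 2 * N%:R * c + 1 ->
  (c - 1) * (K - 2 * N%:R) * K * \sum_(0 <= i < N) (pivot K i)^-1 <= 1 ->
  (forall i, (i < N)%N -> y i = z - h * psum g i) ->
  y N = z - h * c * psum g N ->
  - (z ^+ 2 / (4 * N%:R * h * c + 2)) <=
  \sum_(0 <= i < N) (chain_wt K c i.+1 - chain_wt K c i) *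
     (g i ^+ 2 / 2 - g i * y i) +
  (1 - chain_wt K c N) * (g N ^+ 2 / 2 - g N * y N) +
  \sum_(0 <= i < N) chain_wt K c i.+1 *
     (g i.+1 * (y i - y i.+1) + (g i - g i.+1) ^+ 2 / 2).
Proof.
move=> N0 c1 /andP[h0 h1] eK hpsi hy hyN.
have Nc : N%:R <= N%:R * c by rewrite ler_peMr.
have N1 : 1 <= N%:R :> R by rewrite ler1n.
have hK : N%:R < K by rewrite eK; nra.
have c0 : 0 <= c by lra.
have iK i : (i < N)%N -> i.+1%:R < K.
  by move=> iN; apply: le_lt_trans hK; rewrite ler_nat.
set aN := chain_wt K c N; set e := g N.
have aN1 : aN <= 1.
  rewrite /aN /chain_wt ler_pdivrMr ?subr_gt0 // mul1r eK; lra.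
have a0 i : (i <= N)%N -> 0 <= chain_wt K c i.
  move=> iN; rewrite /chain_wt divr_ge0 ?mulr_ge0 // subr_ge0.
  by rewrite (le_trans _ (ltW hK)) // ler_nat.
set V := \sum_(0 <= i < N) (chain_wt K c i.+1 - chain_wt K c i) * g i.
(* The mean of g_0, ..., g_N under the multipliers q_m, whose total is 1. It is the form paired with
   z. *)
pose W := V + (1 - aN) * e.
set Q0 := \sum_(0 <= i < N) (chain_wt K c i.+1 - chain_wt K c i) * g i ^+ 2.
set C0 := \sum_(0 <= i < N) chain_wt K c i.+1 * (g i - g i.+1) ^+ 2.
set M := \sum_(0 <= i < N)
  (chain_wt K c i.+1 - chain_wt K c i) * (g i * psum g i).
set G := \sum_(0 <= i < N) chain_wt K c i.+1 * (g i.+1 * g i).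
have C00 : 0 <= C0.
  rewrite /C0 big_nat; apply: sumr_ge0 => i /andP[_ iN].
  by rewrite mulr_ge0 ?sqr_ge0 ?a0.
have jensen : W ^+ 2 <= Q0 + (1 - aN) * e ^+ 2 + C0.
  have hj : 0 <= \sum_(0 <= i < N)
      (chain_wt K c i.+1 - chain_wt K c i) * (g i - W) ^+ 2.
    rewrite big_nat; apply: sumr_ge0 => i /andP[_ iN].
    by rewrite mulr_ge0 ?sqr_ge0 // subr_ge0 chain_wt_homo ?iK.
  rewrite sum_gap_jensen -/V -/Q0 -/aN in hj.
  have he : 0 <= (1 - aN) * (e - W) ^+ 2 by rewrite mulr_ge0 ?sqr_ge0 ?subr_ge0.
  rewrite -subr_ge0.
  have -> : Q0 + (1 - aN) * e ^+ 2 + C0 - W ^+ 2 = C0 +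
    (Q0 - 2 * W * V + W ^+ 2 * aN) + (1 - aN) * (e - W) ^+ 2.
    by rewrite /W; ring.
  by do 2?apply: addr_ge0.
(* The case h = 1. The gaps sum to alpha_N, so W is e plus the weighted sum of u = g - e. By [haN]
   the terms in e agree on both sides, which leaves [chain_dominates_rank_one] for u. *)
have full : K * W ^+ 2 <= Q0 + (1 - aN) * e ^+ 2 + C0 +
    2 * (M + G + (c - aN) * (e * psum g N)).
  have hu := chain_dominates_rank_one (fun i => g i - e) N0 c1 eK hpsi.
  have hs := sum_wt_sqr K c g N.
  rewrite !big_split /= -big_distrr big_split /= -/Q0 -/C0 -/M -/G -/aN -/e in hs.
  have hq := quadratic_shift c e g hK.
  rewrite /= -/aN in hq.
  rewrite !big_split /= in hq.
  have hV : \sum_(0 <= i < N) (chain_wt K c i.+1 - chain_wt K c i) * (g i - e) =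
      V - e * aN.
    under eq_bigr do rewrite mulrBr.
    by rewrite sumrB -big_distrl /= telescope_sumr // chain_wt0 subr0 mulrC.
  rewrite hV in hu hq.
  have haN : K * aN + (c - aN) * N%:R + 1 = K.
    have hne : K - N%:R != 0 by rewrite gt_eqF // subr_gt0.
    rewrite /aN /chain_wt; rewrite eK in hne *; by field.
  rewrite big_split /= in hu.
  move: haN hq hs hu; rewrite /W; clear.
  set X1 := \sum_(0 <= i < N) _; set X2 := \sum_(0 <= i < N) _.
  set X3 := \sum_(0 <= i < N) _; set X4 := \sum_(0 <= i < N) _.
  set n := N%:R; clearbody n e aN V Q0 C0 M G X1 X2 X3 X4.
  move: (psum g N) => S haN hq hs hu.
  have : e ^+ 2 * (K * aN + (c - aN) * n + 1) = e ^+ 2 * K by rewrite haN.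
  lra.
(* Consecutive points differ by h g_i, except that extrapolation adds h (c - 1) [psum g N] on the
   last edge. *)
have eG : \sum_(0 <= i < N) chain_wt K c i.+1 *
     (g i.+1 * (y i - y i.+1) + (g i - g i.+1) ^+ 2 / 2) =
   C0 / 2 + h * G + h * aN * (c - 1) * (e * psum g N).
  have -> : C0 / 2 = \sum_(0 <= i < N)
      chain_wt K c i.+1 * ((g i - g i.+1) ^+ 2 / 2).
    by rewrite /C0 big_distrl /=; apply: eq_bigr => i _; rewrite mulrA.
  rewrite /e /aN /G; clear -N0 hy hyN; case: N N0 hy hyN => // n _ hy hyN.
  rewrite !big_nat_recr //= hyN hy // !psumS.
  rewrite (_ : \sum_(0 <= i < n) chain_wt K c i.+1 *
       (g i.+1 * (y i - y i.+1) + (g i - g i.+1) ^+ 2 / 2) =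
     \sum_(0 <= i < n) chain_wt K c i.+1 * ((g i - g i.+1) ^+ 2 / 2) +
     h * \sum_(0 <= i < n) chain_wt K c i.+1 * (g i.+1 * g i)); first by ring.
  rewrite big_distrr -big_split /= !big_nat; apply: eq_bigr => i /andP[_ iN].
  by rewrite !hy ?psumS ?ltnS ?(ltnW iN) //; ring.
have eQ : \sum_(0 <= i < N) (chain_wt K c i.+1 - chain_wt K c i) *
     (g i ^+ 2 / 2 - g i * y i) = Q0 / 2 - z * V + h * M.
  rewrite /Q0 /V /M !big_distrr big_distrl -sumrB -big_split /= !big_nat.
  by apply: eq_bigr => i /andP[_ iN]; rewrite hy //; ring.
rewrite eG eQ hyN.
have t0 : 0 < 2 * N%:R * h * c + 1.
  by rewrite ltr_pwDr // !mulr_ge0 // ltW.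
(* The convex combination of [full] and [jensen] with weights h and 1 - h; h K + 1 - h = 2Nhc +
   1. *)
have mix : (2 * N%:R * h * c + 1) * W ^+ 2 <= Q0 + (1 - aN) * e ^+ 2 + C0 +
    2 * h * (M + G + (c - aN) * (e * psum g N)).
  have h2 := ler_wpM2l (ltW h0) full.
  have h3 : (1 - h) * W ^+ 2 <= (1 - h) * (Q0 + (1 - aN) * e ^+ 2 + C0).
    by rewrite ler_wpM2l // subr_ge0.
  have h4 := lerD h2 h3; rewrite eK in h4; lra.
set t := 2 * N%:R * h * c + 1 in t0 mix *.
have -> : 4 * N%:R * h * c + 2 = 2 * t by rewrite /t; ring.
(* Young's inequality for z W, with the weight t supplied by [mix]. *)
have hz : 0 <= (t * W - z) ^+ 2 / t by rewrite divr_ge0 ?sqr_ge0 // ltW.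
have ez : (t * W - z) ^+ 2 / t = t * W ^+ 2 - 2 * z * W + z ^+ 2 / t.
  by field; rewrite gt_eqF.
rewrite ez in hz.
have -> : z ^+ 2 / (2 * t) = z ^+ 2 / t / 2 by field; rewrite gt_eqF.
move: hz mix; rewrite /W; clear.
move: (z ^+ 2 / t) (psum g N) => Z S.
lra.
Qed.

(** * Monotonicity of the summands of psi_N *)

Lemma psi_denE (R : realType) N i (c : R) :
  psi_den N i c = pivot (2 * N%:R * c + 1) i.
Proof. by rewrite /psi_den /pivot; ring. Qed.

Lemma psi_term_homo (R : realType) (N i : nat) (c c' : R) :
  (i < N)%N -> 1 <= c -> c <= c' ->
  (c - 1) * (2 * N%:R * c - 2 * N%:R + 1) * (2 * N%:R * c + 1) / psi_den N i c <=
  (c' - 1) * (2 * N%:R * c' - 2 * N%:R + 1) * (2 * N%:R * c' + 1)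
    / psi_den N i c'.
Proof.
move=> iN c1 cc'.
have iN1 : i%:R + 1 <= N%:R :> R by rewrite natr1 ler_nat.
have i0 : 0 <= i%:R :> R by [].
rewrite !psi_denE.
have N1 : 1 <= N%:R :> R by lra.
have hp (x : R) : 1 <= x -> 0 < pivot (2 * N%:R * x + 1) i.
  move=> x1; apply: pivot_gt0; rewrite -addn1 natrD.
  have : N%:R <= N%:R * x by rewrite ler_peMr.
  by lra.
have p1 := hp _ c1; have p2 := hp _ (le_trans c1 cc').
have Nc : N%:R <= N%:R * c by rewrite ler_peMr.
have Ncc : N%:R * c <= N%:R * c' by rewrite ler_wpM2l.
(* The factor 2Nc - 2N + 1 is increasing by itself; the remaining quotient is compared by
   cross-multiplication. *)
rewrite -!mulrA [_ * (_ * (_ / _))]mulrCA [leRHS]mulrCA.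
apply: ler_pM.
- by lra.
- by apply: mulr_ge0; [lra | apply: divr_ge0; [lra | rewrite mulrA; exact: ltW]].
- by lra.
rewrite !mulrA ler_pdivrMr // [leRHS]mulrAC ler_pdivlMr //.
rewrite /pivot; clear - c1 cc' i0 iN1 N1.
move: (i%:R : R) (N%:R : R) i0 iN1 N1 => x n x0 xn n1.
rewrite -subr_ge0.
set G := (1 + 2 * x) * ((2 * n * c + 1) * (2 * n * c' + 1)) -
  2 * x * (1 + x) * (2 * n * (c + c' - 1) + 1).
rewrite (_ : _ - _ = (c' - c) * G); last by rewrite /G; ring.
apply: mulr_ge0; first by rewrite subr_ge0.
(* The subtracted part of G is bounded in two steps: x + 1 <= n replaces 2x(1 + x) by (1 + 2x) n,
   and [h3] absorbs that factor n. *)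
have h1 : 0 <= 2 * n * (c + c' - 1) + 1 by nra.
have h2 : 2 * x * (1 + x) <= (1 + 2 * x) * n by nra.
have h3 : n * (2 * n * (c + c' - 1) + 1) <= (2 * n * c + 1) * (2 * n * c' + 1).
  have h4 : 0 <= (c - 1) * c' + (c' - 1) * c + 1 by nra.
  have h5 : 0 <= 2 * n ^+ 2 * ((c - 1) * c' + (c' - 1) * c + 1).
    by rewrite mulr_ge0 // mulr_ge0 ?sqr_ge0.
  have h6 : 0 <= n * (2 * c + 2 * c' - 1) by rewrite mulr_ge0 //; lra.
  lra.
rewrite /G subr_ge0 (le_trans (ler_wpM2r h1 h2)) // -[leLHS]mulrA.
by rewrite ler_wpM2l //; lra.
Qed.

(** The sum in psi_N equals 1 at c_crit, and each summand can only decrease from c_crit down to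
    c. *)
Lemma largest_root_bound (R : realType) (N : nat) (c ccrit : R) :
  psi_largest_root N ccrit -> 1 <= c <= ccrit ->
  let K := 2 * N%:R * c + 1 in
  (c - 1) * (K - 2 * N%:R) * K * \sum_(0 <= i < N) (pivot K i)^-1 <= 1.
Proof.
move=> [[_ /eqP hroot] _] /andP[c1 cc].
rewrite /psi subr_eq0 in hroot.
rewrite /= [leRHS](eqP hroot) big_distrr /= !big_nat.
apply: ler_sum => i /andP[_ iN].
have := psi_term_homo iN c1 cc; rewrite psi_denE; apply: le_trans.
by rewrite le_eqVlt; apply/orP; left; apply/eqP; congr (_ * _ * _ / _); ring.
Qed.

Local Open Scope classical_set_scope.

(** * Smooth convex functions *)

Definition dot (R : realType) (d : nat) (u v : 'rV[R]_d) : R :=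
  \sum_(i < d) u 0 i * v 0 i.

Lemma enorm_sqr (R : realType) (d : nat) (u : 'rV[R]_d) :
  enorm u ^+ 2 = dot u u.
Proof.
rewrite /enorm sqr_sqrtr; first by apply: eq_bigr => i _; rewrite expr2.
by apply: sumr_ge0 => i _; rewrite sqr_ge0.
Qed.

Lemma enorm_ge0 (R : realType) (d : nat) (u : 'rV[R]_d) : 0 <= enorm u.
Proof. exact: sqrtr_ge0. Qed.

Lemma dotDr (R : realType) (d : nat) (u v w : 'rV[R]_d) :
  dot u (v + w) = dot u v + dot u w.
Proof. by rewrite /dot -big_split; apply: eq_bigr => i _; rewrite mxE mulrDr. Qed.

Lemma dotZr (R : realType) (d : nat) (a : R) (u v : 'rV[R]_d) :
  dot u (a *: v) = a * dot u v.
Proof. by rewrite /dot big_distrr; apply: eq_bigr => i _; rewrite mxE mulrCA. Qed.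

Lemma dotC (R : realType) (d : nat) (u v : 'rV[R]_d) : dot u v = dot v u.
Proof. by apply: eq_bigr => i _; rewrite mulrC. Qed.

Lemma dotNr (R : realType) (d : nat) (u v : 'rV[R]_d) : dot u (- v) = - dot u v.
Proof. by rewrite -scaleN1r dotZr mulN1r. Qed.

Lemma dotZl (R : realType) (d : nat) (a : R) (u v : 'rV[R]_d) :
  dot (a *: u) v = a * dot u v.
Proof. by rewrite dotC dotZr dotC. Qed.

Lemma dotNl (R : realType) (d : nat) (u v : 'rV[R]_d) : dot (- u) v = - dot u v.
Proof. by rewrite dotC dotNr dotC. Qed.

Lemma dotBr (R : realType) (d : nat) (u v w : 'rV[R]_d) :
  dot u (v - w) = dot u v - dot u w.
Proof. by rewrite dotDr dotNr. Qed.

Lemma dotBl (R : realType) (d : nat) (u v w : 'rV[R]_d) :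
  dot (u - v) w = dot u w - dot v w.
Proof. by rewrite dotC dotBr dotC [dot w v]dotC. Qed.

Lemma dot_ge0 (R : realType) (d : nat) (u : 'rV[R]_d) : 0 <= dot u u.
Proof. by apply: sumr_ge0 => i _; rewrite -expr2 sqr_ge0. Qed.

Lemma enormZ (R : realType) (d : nat) (a : R) (u : 'rV[R]_d) :
  enorm (a *: u) = `|a| * enorm u.
Proof.
rewrite /enorm -sqrtr_sqr -sqrtrM ?sqr_ge0 // big_distrr /=.
by congr Num.sqrt; apply: eq_bigr => i _; rewrite mxE exprMn.
Qed.

(** Expand the square of u - b v and divide by 2b; if b = 0 then u = 0. *)
Lemma dot_le (R : realType) (d : nat) (b : R) (u v : 'rV[R]_d) :
  0 <= b -> enorm u <= b * enorm v -> dot u v <= b * dot v v.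
Proof.
move=> b0 huv.
have huv2 : dot u u <= b ^+ 2 * dot v v.
  rewrite -!enorm_sqr -exprMn ler_pXn2r ?nnegrE ?mulr_ge0 ?enorm_ge0 //.
have [bE|bN] := eqVneq b 0.
  rewrite bE mul0r; rewrite bE expr0n mul0r in huv2.
  have u0 : dot u u = 0 by apply/eqP; rewrite eq_le huv2 dot_ge0.
  rewrite /dot big1 // => i _; suff -> : u 0 i = 0 by rewrite mul0r.
  apply/eqP; rewrite -sqrf_eq0 expr2; apply/eqP; move: i (isT).
  by apply: psumr_eq0P => // i _; rewrite -expr2 sqr_ge0.
have := dot_ge0 (u - b *: v).
rewrite dotBr dotZr !dotBl !dotZl [dot v u]dotC => h.
have bp : 0 < b by rewrite lt_neqAle eq_sym bN.
have h2 : 2 * (b * dot u v) <= 2 * (b * (b * dot v v)).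
  by rewrite expr2 in huv2; lra.
by rewrite -(ler_pM2l bp); lra.
Qed.

Lemma derive_dot (R : realType) (d : nat) (f : 'rV[R]_d -> R^o) x v :
  differentiable f x -> 'D_v f x = dot (gradient f x) v.
Proof.
move=> df; rewrite deriveE // [v in LHS]row_sum_delta linear_sum /dot.
apply: eq_bigr => i _.
by rewrite linearZ /= mxE deriveE // mulrC.
Qed.

Lemma is_derive_line (R : realType) (d : nat) (f : 'rV[R]_d -> R^o)
    (x v : 'rV[R]_d) (t : R) : differentiable f (x + t *: v) ->
  is_derive t (1 : R) (fun s : R => f (x + s *: v) : R)
    (dot (gradient f (x + t *: v)) v).
Proof.
move=> df.
have eq : (fun h : R => h^-1 *: (((fun s : R => f (x + s *: v) : R) \o shift t)
      (h *: (1 : R)) - f (x + t *: v))) =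
    (fun h : R => h^-1 *: ((f \o shift (x + t *: v)) (h *: v) - f (x + t *: v))).
  apply/funext => h /=; congr (_ *: (f _ - _)).
  by rewrite [h *: 1]mulr1 scalerDl addrCA.
have dv : derivable f (x + t *: v) v by exact: diff_derivable.
split; first by rewrite /derivable eq.
by rewrite -derive_dot // /derive eq.
Qed.

(** Convexity bounds the difference quotient along y - x by f y - f x for steps t in (0, 1); then t
    tends to 0 from the right. *)
Lemma convex_gradient_le (R : realType) (d : nat) (f : 'rV[R]_d -> R^o) x y :
  convex f -> differentiable f x -> f x + dot (gradient f x) (y - x) <= f y.
Proof.
move=> cf df; rewrite -derive_dot // addrC -lerBrDr.
set v := y - x.
have dv : derivable f x v by exact: diff_derivable.
apply: (cvgr_to_le (cvg_dnbhs_at_right dv)).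
near=> t.
have t0 : 0 < t by near: t; exact: nbhs_right_gt.
have t1 : t < 1 by near: t; exact: nbhs_right_lt.
have := cf (Itv01 (ltW t0) (ltW t1)) y x.
rewrite !in_setT => /(_ isT isT).
rewrite convRE /conv /= /unstable.onem => h.
have -> : t *: v + x = t *: y + (1 - t) *: x.
  by rewrite /v scalerBr scalerBl scale1r addrA addrAC.
rewrite /GRing.scale /= mulrC ler_pdivrMr //.
lra.
Unshelve. all: by end_near. Qed.

(** The gap F along the segment has nonpositive derivative by the Lipschitz bound, so the mean value
    theorem gives F 1 <= F 0. *)
Lemma descent_lemma (R : realType) (d : nat) (L : R) (f : 'rV[R]_d -> R^o) x y :
  0 <= L -> smooth L f ->
  f y <= f x + dot (gradient f x) (y - x) + L / 2 * dot (y - x) (y - x).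
Proof.
move=> L0 [df Lf]; set v := y - x.
pose df' t := dot (gradient f (x + t *: v)) v - dot (gradient f x) v -
  L * dot v v * t.
pose F t := f (x + t *: v) - t * dot (gradient f x) v - L / 2 * dot v v * t ^+ 2.
have F' (t : R) : is_derive t (1:R) F (df' t).
  have h := is_derive_line (df (x + t *: v)).
  rewrite /F /df'.
  apply: is_derive_eq.
  rewrite -[LHS]/(dot (gradient f (x + t *: v)) v -
    (t * 0 + dot (gradient f x) v * 1) - L / 2 * dot v v * (t * 1 + t * 1)).
  by field.
have Fc : {within `[0, 1], continuous F}.
  apply: continuous_subspaceT => t.
  by apply: differentiable_continuous; apply/derivable1_diffP; case: (F' t).
have [t] := MVT ltr01 (fun t _ => F' t) Fc.
rewrite in_itv /= => /andP[t0 t1]; rewrite subr0 mulr1.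
have : df' t <= 0.
  rewrite /df' -dotBl subr_le0 mulrAC.
  apply: dot_le; first by rewrite mulr_ge0 // ltW.
  rewrite -mulrA -[X in _ * (X * _)](ger0_norm (ltW t0)) -enormZ.
  by have := Lf (x + t *: v) x; rewrite [x + _]addrC addrK.
rewrite /F !scale1r !scale0r addr0 /v subrKC.
move=> h1 h2; rewrite !(mul0r, mul1r, expr0n, expr1n, mulr0, mulr1, subr0) in h2.
lra.
Qed.

(** Compare at z the tangent lower bound from y with the quadratic upper bound from x; z minimises
    the difference of the latter and the former. *)
Lemma smooth_convex_interpolation (R : realType) (d : nat) (L : R)
    (f : 'rV[R]_d -> R^o) x y : 0 < L -> convex f -> smooth L f ->
  f y + dot (gradient f y) (x - y) +
    dot (gradient f x - gradient f y) (gradient f x - gradient f y) / (2 * L)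
  <= f x.
Proof.
set g := gradient f; move=> L0 cf sf; case: (sf) => df _.
pose z := x - L^-1 *: (g x - g y).
have h1 := convex_gradient_le z cf (df y).
have h2 := descent_lemma x z (ltW L0) sf.
have zx : z - x = - (L^-1 *: (g x - g y)) by rewrite /z addrC addKr.
have zy : z - y = (x - y) - L^-1 *: (g x - g y) by rewrite /z addrAC.
rewrite zx !dotNr dotNl opprK !dotZr dotZl in h2.
rewrite zy dotBr dotZr in h1.
rewrite -!/g in h1 h2 *.
set D := dot (g x - g y) _ in h2 *.
have e : D = dot (g x) (g x - g y) - dot (g y) (g x - g y) by rewrite /D dotBl.
have eL : L / 2 * (L^-1 * (L^-1 * D)) = D / (2 * L) by field; rewrite gt_eqF.
rewrite eL in h2.
have -> : D / (2 * L) = L^-1 * D - D / (2 * L) by field; rewrite gt_eqF.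
have eD : L^-1 * D = L^-1 * dot (g x) (g x - g y) - L^-1 * dot (g y) (g x - g y).
  by rewrite e mulrBr.
lra.
Qed.

(** A step of length 1/L along the negative gradient would lower f by at least |g|^2 / (2L). *)
Lemma gradient_minimizer (R : realType) (d : nat) (L : R)
    (f : 'rV[R]_d -> R^o) xs : 0 < L -> smooth L f -> minimizer f xs ->
  gradient f xs = 0.
Proof.
move=> L0 sf hm; set g := gradient f xs.
have h := descent_lemma xs (xs - L^-1 *: g) (ltW L0) sf.
have hz : xs - L^-1 *: g - xs = - (L^-1 *: g) by rewrite addrC addKr.
rewrite hz !dotNr dotNl opprK !dotZr dotZl -/g in h.
have := le_trans (hm _) h.
have -> : L / 2 * (L^-1 * (L^-1 * dot g g)) = L^-1 * dot g g / 2.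
  by field; rewrite gt_eqF.
move=> h1; have h2 : L^-1 * dot g g <= 0 by lra.
rewrite pmulr_rle0 ?invr_gt0 // in h2.
have g0 : dot g g = 0 by apply/eqP; rewrite eq_le h2 dot_ge0.
apply/rowP => i; rewrite [in RHS]mxE.
apply/eqP; rewrite -sqrf_eq0 expr2; apply/eqP; move: i (isT).
by apply: psumr_eq0P => // i _; rewrite -expr2 sqr_ge0.
Qed.

Local Close Scope classical_set_scope.

(** * The upper bound for extrapolated gradient descent *)

Lemma chain_wt_abel (R : realFieldType) (K c : R) (F : nat -> R) n :
  \sum_(0 <= i < n) (chain_wt K c i.+1 - chain_wt K c i) * F i +
  \sum_(0 <= i < n) chain_wt K c i.+1 * (F i.+1 - F i) = chain_wt K c n * F n.
Proof.
elim: n => [|n IH]; first by rewrite !big_geq // chain_wt0; ring.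
rewrite !big_nat_recr //= addrACA IH; ring.
Qed.

(** By Abel summation the chain and star multipliers cancel every F_i with i < N; F_N keeps the
    weight alpha_N + (1 - alpha_N) = 1. *)
Lemma chain_combination (R : realFieldType) (K c : R) (F a b : nat -> R) N :
  0 <= c -> N%:R < K -> chain_wt K c N <= 1 ->
  (forall i, (i <= N)%N -> F i <= - a i) ->
  (forall i, (i < N)%N -> F i.+1 - F i <= - b i) ->
  F N <= - (\sum_(0 <= i < N) (chain_wt K c i.+1 - chain_wt K c i) * a i +
            (1 - chain_wt K c N) * a N +
            \sum_(0 <= i < N) chain_wt K c i.+1 * b i).
Proof.
move=> c0 hK aN1 Fa Fb.
have iK i : (i < N)%N -> i.+1%:R < K.
  by move=> iN; apply: le_lt_trans hK; rewrite ler_nat.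
have h1 : \sum_(0 <= i < N) (chain_wt K c i.+1 - chain_wt K c i) * F i <=
    - \sum_(0 <= i < N) (chain_wt K c i.+1 - chain_wt K c i) * a i.
  rewrite -sumrN !big_nat; apply: ler_sum => i /andP[_ iN].
  by rewrite -[leRHS]mulrN ler_wpM2l ?Fa ?(ltnW iN) // subr_ge0 chain_wt_homo ?iK.
have h2 : \sum_(0 <= i < N) chain_wt K c i.+1 * (F i.+1 - F i) <=
    - \sum_(0 <= i < N) chain_wt K c i.+1 * b i.
  rewrite -sumrN !big_nat; apply: ler_sum => i /andP[_ iN].
  rewrite -[leRHS]mulrN ler_wpM2l ?Fb // /chain_wt divr_ge0 ?mulr_ge0 //.
  by rewrite subr_ge0 ltW ?iK.
have h3 : (1 - chain_wt K c N) * F N <= - ((1 - chain_wt K c N) * a N).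
  by rewrite -[leRHS]mulrN ler_wpM2l ?subr_ge0 ?Fa.
have := chain_wt_abel K c F N.
lra.
Qed.

Lemma gd_sum (R : realType) (d : nat) (L h : R) (f : 'rV[R]_d -> R^o)
    (x0 : 'rV[R]_d) n :
  gd L (fun=> h) f x0 n =
  x0 - (h / L) *: \sum_(0 <= k < n) gradient f (gd L (fun=> h) f x0 k).
Proof.
elim: n => [|n IH]; first by rewrite big_geq // scaler0 subr0.
by rewrite /= {1}IH big_nat_recr //= scalerDr opprD addrA.
Qed.

Lemma extrapolated_gd_le (R : realType) (d N : nat) (h c ccrit L : R)
    (f : 'rV[R]_d -> R^o) (xs x0 : 'rV[R]_d) :
  (1 <= N)%N -> 0 < h <= 1 -> psi_largest_root N ccrit -> 1 <= c <= ccrit ->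
  0 < L -> convex f -> smooth L f -> minimizer f xs ->
  f (x0 + c *: (gd L (fun=> h) f x0 N - x0)) - f xs <=
  L * enorm (x0 - xs) ^+ 2 / (4 * N%:R * h * c + 2).
Proof.
move=> N1 hh hcrit hc L0 cf sf hmin.
have hpsi := largest_root_bound hcrit hc; rewrite /= in hpsi.
have c1 : 1 <= c by case/andP: hc.
have gs0 := gradient_minimizer L0 sf hmin.
set xN := gd L (fun=> h) f x0 N; set xsig := x0 + _.
set K := 2 * N%:R * c + 1 in hpsi.
have Nc : N%:R <= N%:R * c by rewrite ler_peMr.
have n1 : 1 <= N%:R :> R by rewrite ler1n.
have hK : N%:R < K by rewrite /K; lra.
have c0 : 0 <= c by lra.
have aN1 : chain_wt K c N <= 1.
  rewrite /chain_wt ler_pdivrMr ?subr_gt0 // mul1r /K; lra.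
(* The extrapolated point takes index N in place of the last iterate. *)
pose y i := if (i < N)%N then gd L (fun=> h) f x0 i else xsig.
have yN : y N = xsig by rewrite /y ltnn.
pose g i := gradient f (y i).
(* Dividing gradients by L reduces to L = 1. The certificate is quadratic, so it is applied to each
   coordinate j and summed. *)
pose gj j i := g i 0 j / L.
pose yj j i := (y i - xs) 0 j.
pose zj j := (x0 - xs) 0 j.
pose a i := L * \sum_(j < d) (gj j i ^+ 2 / 2 - gj j i * yj j i).
pose b i := L * \sum_(j < d) (gj j i.+1 * (yj j i - yj j i.+1) +
  (gj j i - gj j i.+1) ^+ 2 / 2).
have psumE j i : (i <= N)%N ->
    psum (gj j) i =
    L^-1 * (\sum_(0 <= k < i) gradient f (gd L (fun=> h) f x0 k)) 0 j.
  move=> iN; rewrite summxE /psum big_distrr /= !big_nat.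
  apply: eq_bigr => k /andP[_ ki].
  by rewrite /gj /g /y (leq_trans ki iN) mulrC.
have hy j i : (i < N)%N -> yj j i = zj j - h * psum (gj j) i.
  move=> iN; rewrite /yj /zj psumE ?(ltnW iN) // /y iN gd_sum !mxE.
  by ring.
have hyN j : yj j N = zj j - h * c * psum (gj j) N.
  rewrite /yj /zj psumE // yN /xsig /xN gd_sum !mxE.
  by ring.
have cert j := extrapolated_certificate N1 c1 hh (erefl K) hpsi
  (fun i => @hy j i) (hyN j).
have star i : (i <= N)%N -> f (y i) - f xs <= - a i.
  move=> _; have := smooth_convex_interpolation xs (y i) L0 cf sf.
  rewrite gs0 sub0r dotNl dotNr opprK -/(g i).
  suff -> : a i = dot (g i) (xs - y i) + dot (g i) (g i) / (2 * L) by lra.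
  rewrite /a /dot big_distrr big_distrl -big_split /=; apply: eq_bigr => j _.
  by rewrite /gj /yj !mxE; field; rewrite gt_eqF.
have edge i : (i < N)%N -> (f (y i.+1) - f xs) - (f (y i) - f xs) <= - b i.
  move=> _; have := smooth_convex_interpolation (y i) (y i.+1) L0 cf sf.
  rewrite -/(g i) -/(g i.+1).
  suff -> : b i = dot (g i.+1) (y i - y i.+1) +
    dot (g i - g i.+1) (g i - g i.+1) / (2 * L) by lra.
  rewrite /b /dot big_distrr big_distrl -big_split /=; apply: eq_bigr => j _.
  by rewrite /gj /yj !mxE; field; rewrite gt_eqF.
have := chain_combination (F := fun i => f (y i) - f xs) c0 hK aN1 star edge.
rewrite yN => /le_trans; apply.
rewrite lerNl.
have -> : - (L * enorm (x0 - xs) ^+ 2 / (4 * N%:R * h * c + 2)) =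
    L * \sum_(j < d) - (zj j ^+ 2 / (4 * N%:R * h * c + 2)).
  rewrite enorm_sqr sumrN -big_distrl /= mulrN mulrA.
  by congr (- (_ * _ / _)).
have := ler_wpM2l (ltW L0) (ler_sum (index_enum 'I_d)
  (fun j (_ : true) => cert j)).
move=> /le_trans; apply.
rewrite le_eqVlt; apply/orP; left; apply/eqP.
rewrite !big_split /= !mulrDr; congr (_ + _ + _).
- rewrite exchange_big /= big_distrr /=; apply: eq_bigr => i _.
  by rewrite /a mulrCA -big_distrr.
- by rewrite /a mulrCA -big_distrr.
- rewrite exchange_big /= big_distrr /=; apply: eq_bigr => i _.
  by rewrite /b mulrCA -big_distrr.
Qed.

(** * The Huber function *)

Local Open Scope classical_set_scope.

Definition clamp (R : realType) (eta s : R) : R :=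
  if s < - eta then - eta else if s < eta then s else eta.

(** For eta >= 0 this is s^2 / 2 when |s| <= eta and eta |s| - eta^2 / 2 beyond, written through its
    derivative [clamp]. *)
Definition huber (R : realType) (eta s : R) : R :=
  s * clamp eta s - clamp eta s ^+ 2 / 2.

Lemma clamp_itv (R : realType) (eta s : R) : 0 <= eta ->
  - eta <= clamp eta s <= eta.
Proof. by rewrite /clamp => eta0; case: ltP => h1; [|case: ltP => h2]; lra. Qed.

Lemma clamp_high (R : realType) (eta s : R) : 0 <= eta -> eta <= s ->
  clamp eta s = eta.
Proof. by rewrite /clamp => e0 es; rewrite !ltNge es (le_trans _ es) //; lra. Qed.

Lemma clamp_lipschitz (R : realType) (eta s t : R) : 0 <= eta ->
  `|clamp eta s - clamp eta t| <= `|s - t|.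
Proof.
move=> e0; have [st|ts] := leP t s.
  rewrite [leRHS]ger0_norm ?subr_ge0 // ler_norml /clamp.
  by do 4?[case: ltP => ?]; lra.
rewrite [leRHS]ltr0_norm ?subr_lt0 // ler_norml /clamp.
by do 4?[case: ltP => ?]; lra.
Qed.

(* [huber eta] is the conjugate of [v ^+ 2 / 2] restricted to [[- eta, eta]]. *)
Lemma huber_ge (R : realType) (eta s v : R) : - eta <= v <= eta ->
  s * v - v ^+ 2 / 2 <= huber eta s.
Proof.
rewrite /huber /clamp => /andP[h1 h2].
have sq (a : R) : 0 <= (v - a) ^+ 2 by rewrite sqr_ge0.
case: ltP => h3; [|case: ltP => h4].
- have : 0 <= (v + eta) * (- eta - s) by rewrite mulr_ge0; lra.
  by have := sq (- eta); lra.
- by have := sq s; lra.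
- have : 0 <= (eta - v) * (s - eta) by rewrite mulr_ge0; lra.
  by have := sq eta; lra.
Qed.

(** Apply [huber_ge] at each point with the slope of the other. Hence the difference quotient with
    step h is within |h| of [clamp eta s], which gives the derivative. *)
Lemma huber_taylor (R : realType) (eta s t : R) : 0 <= eta ->
  0 <= huber eta t - huber eta s - clamp eta s * (t - s) <= (t - s) ^+ 2.
Proof.
move=> e0.
have h1 := huber_ge t (clamp_itv s e0); have h2 := huber_ge s (clamp_itv t e0).
have h3 : (clamp eta t - clamp eta s) * (t - s) <= (t - s) ^+ 2.
  rewrite (le_trans (ler_norm _)) // normrM -real_normK ?num_real // expr2.
  by rewrite ler_wpM2r // clamp_lipschitz.
by apply/andP; split; [rewrite /huber in h1 * | rewrite /huber in h2 *]; lra.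
Qed.

Lemma is_derive_huber (R : realType) (eta s : R) : 0 <= eta ->
  is_derive s (1 : R) (huber eta : R -> R) (clamp eta s).
Proof.
move=> e0.
have hc : h^-1 *: ((huber eta \o shift s) (h *: (1:R)) - huber eta s) @[h --> 0^']
    --> clamp eta s.
  apply/cvgrPdist_le => e epos; near=> h.
  have h0 : h != 0 by near: h; exact: nbhs_dnbhs_neq.
  have he : `|h| <= e.
    near: h; exact: dnbhs0_le.
  apply: le_trans he.
  have /andP[t1 t2] := huber_taylor s (h + s) e0.
  rewrite /= [h *: 1]mulr1.
  have -> : clamp eta s - h^-1 *: (huber eta (h + s) - huber eta s) =
    - (h^-1 * (huber eta (h + s) - huber eta s - clamp eta s * h)).
    by rewrite /GRing.scale /=; field.
  rewrite addrK in t1 t2.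
  rewrite normrN normrM (ger0_norm t1) normfV ler_pdivrMl ?normr_gt0 //.
  by rewrite -expr2 real_normK ?num_real.
split; first by apply/cvg_ex; exists (clamp eta s).
exact: cvg_lim.
Unshelve. all: by end_near. Qed.

Definition huber_row (R : realType) (d : nat) (L eta : R)
    (x : 'rV[R]_d.+1) : R^o :=
  L * huber eta (x 0 ord0).

Lemma huber_row_differentiable (R : realType) (d : nat) (L eta : R)
    (x : 'rV[R]_d.+1) : 0 <= eta -> differentiable (@huber_row R d L eta) x.
Proof.
move=> e0.
have h := is_derive_huber (x 0 ord0) e0.
have dh : differentiable (huber eta : R -> R) (x 0 ord0).
  by apply/derivable1_diffP.
have dc := @differentiable_coord R 1 d.+1 x 0 ord0.
have := differentiable_comp dc dh.
move=> /(differentiableZ L); exact.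
Qed.

Lemma huber_row_gradient (R : realType) (d : nat) (L eta : R)
    (x : 'rV[R]_d.+1) : 0 <= eta ->
  gradient (@huber_row R d L eta) x =
  (L * clamp eta (x 0 ord0)) *: delta_mx 0 ord0.
Proof.
move=> e0; apply/rowP => i; rewrite !mxE /=.
have h := is_derive_huber (x 0 ord0) e0.
have [->|i0] := eqVneq i ord0.
  rewrite mulr1.
  have hL := is_deriveZ L h.
  have hv : 'D_(1 : R) (L \*: (huber eta : R -> R^o)) (x 0 ord0) =
      L * clamp eta (x 0 ord0) by case: hL.
  rewrite -hv /derive.
  set A := (X in lim (X @ _) = _); set B := (X in _ = lim (X @ _)).
  suff -> : A = B by [].
  by apply/funext => t; rewrite /A /B /= /huber_row !mxE /=.
rewrite mulr0 /derive.
rewrite (_ : (fun h : R => _) = cst 0) ?lim_cst //.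
apply/funext => t /=; rewrite /huber_row !mxE /= (eq_sym ord0) (negbTE i0).
by rewrite mulr0 add0r subrr scaler0.
Qed.

Lemma enorm_delta (R : realType) (d : nat) (a : R) (i : 'I_d) :
  enorm (a *: (delta_mx 0 i : 'rV[R]_d)) = `|a|.
Proof.
rewrite /enorm (bigD1 i) //= !mxE !eqxx mulr1 big1 ?addr0 ?sqrtr_sqr // => j ji.
by rewrite !mxE (negbTE ji) andbF mulr0 expr0n.
Qed.

Lemma abs_coord_le_enorm (R : realType) (d : nat) (u : 'rV[R]_d) (i : 'I_d) :
  `|u 0 i| <= enorm u.
Proof.
rewrite -sqrtr_sqr ler_wsqrtr // (bigD1 i) //= lerDl.
by apply: sumr_ge0 => j _; rewrite sqr_ge0.
Qed.

Lemma huber_row_smooth (R : realType) (d : nat) (L eta : R) :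
  0 <= L -> 0 <= eta -> smooth L (@huber_row R d L eta).
Proof.
move=> L0 e0; split=> [x|x y]; first exact: huber_row_differentiable.
rewrite !huber_row_gradient // -scalerBl enorm_delta -mulrBr normrM ger0_norm //.
rewrite ler_wpM2l // (le_trans (clamp_lipschitz _ _ e0)) //.
by have := abs_coord_le_enorm (x - y) ord0; rewrite !mxE.
Qed.

(** The supporting line at the mean m, of slope [clamp eta m], lies below both endpoint values. *)
Lemma huber_row_convex (R : realType) (d : nat) (L eta : R) :
  0 <= L -> 0 <= eta -> convex (@huber_row R d L eta).
Proof.
move=> L0 e0 t x y _ _; rewrite convRE /huber_row /conv /= !mxE /unstable.onem.
set m := t%:num * x 0 ord0 + (1 - t%:num) * y 0 ord0.
have hx := huber_ge (x 0 ord0) (clamp_itv m e0).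
have hy := huber_ge (y 0 ord0) (clamp_itv m e0).
have t0 : 0 <= t%:num :> R by [].
have t1 : 0 <= 1 - t%:num :> R by rewrite subr_ge0.
have h1 := ler_wpM2l t0 hx; have h2 := ler_wpM2l t1 hy.
rewrite !(mulrCA _ L) -mulrDr ler_wpM2l //.
rewrite (le_trans _ (lerD h1 h2)) // {1}/huber {1}/m.
by rewrite le_eqVlt; apply/orP; left; apply/eqP; ring.
Qed.

Lemma huber_row_minimizer (R : realType) (d : nat) (L eta : R) :
  0 <= L -> 0 <= eta -> minimizer (@huber_row R d L eta) 0.
Proof.
move=> L0 e0 x; rewrite /huber_row mxE ler_wpM2l //.
apply: le_trans (huber_ge (x 0 ord0) (v := 0) _); last by lra.
rewrite /huber mul0r mulr0 expr0n /= mul0r subr0 sub0r oppr_le0.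
by rewrite divr_ge0 ?sqr_ge0.
Qed.

(** The bound on D keeps all iterates up to the n-th at first coordinate at least eta, where the
    slope is constant and each step subtracts h eta. *)
Lemma huber_row_gd (R : realType) (d n : nat) (L eta h D : R) :
  0 < L -> 0 <= eta -> 0 <= h -> n%:R * (h * eta) + eta <= D ->
  gd L (fun=> h) (@huber_row R d L eta) (D *: delta_mx 0 ord0) n =
  (D - n%:R * (h * eta)) *: delta_mx 0 ord0.
Proof.
move=> L0 e0 h0; elim: n => [|n IH] hD; first by rewrite mul0r subr0.
have he : 0 <= h * eta by rewrite mulr_ge0.
rewrite -(addn1 n) natrD mulrDl mul1r in hD.
rewrite /= IH; last by lra.
rewrite huber_row_gradient // !mxE /= mulr1 clamp_high //; last by lra.
rewrite scalerA -scalerBl -(addn1 n) natrD; congr (_ *: _).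
by field; rewrite gt_eqF.
Qed.

Lemma extrapolated_gd_tight (R : realType) (d N : nat) (h c L D : R) :
  0 < h -> 1 <= c -> 0 < L -> 0 < D ->
  exists (f : 'rV[R]_d.+1 -> R^o) (xs x0 : 'rV[R]_d.+1),
    [/\ convex f, smooth L f, minimizer f xs & enorm (x0 - xs) = D] /\
    f (x0 + c *: (gd L (fun=> h) f x0 N - x0)) - f xs =
    L * D ^+ 2 / (4 * N%:R * h * c + 2).
Proof.
move=> h0 c1 L0 D0.
have Nh : 0 <= N%:R * h by rewrite mulr_ge0 // ltW.
have Nhc : N%:R * h <= N%:R * h * c by rewrite ler_peMr.
have t0 : 0 < 2 * (N%:R * h * c) + 1 by lra.
(* With this eta, x_sigma has first coordinate eta (1 + Nhc), still on the linear branch, so the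
   value there is L eta^2 (2Nhc + 1) / 2, the claimed bound. *)
pose eta := D / (2 * (N%:R * h * c) + 1).
have eta0 : 0 < eta by rewrite divr_gt0.
have eD : D = eta * (2 * (N%:R * h * c) + 1) by rewrite /eta divfK ?gt_eqF.
have e0 := ltW eta0; have Nhe : 0 <= N%:R * h * c * eta.
  by rewrite mulr_ge0 //; lra.
have Nhe2 : N%:R * h * eta <= N%:R * h * c * eta by rewrite ler_wpM2r.
exists (huber_row L eta), 0, (D *: delta_mx 0 ord0); split; first split.
- by apply: huber_row_convex; rewrite // ltW.
- by apply: huber_row_smooth; rewrite // ltW.
- by apply: huber_row_minimizer; rewrite // ltW.
- by rewrite subr0 enorm_delta gtr0_norm.
rewrite huber_row_gd //; last 2 first.
- exact: ltW.
- by rewrite eD mulrA; lra.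
rewrite -scalerBl scalerA -scalerDl /huber_row !mxE /= !mulr1.
rewrite /huber clamp_high //; last by rewrite eD; lra.
set s := clamp eta 0.
have -> : s = 0 by rewrite /s /clamp; case: ltP => //; [lra | rewrite eta0].
rewrite [in RHS]eD eD.
have t2 : 4 * N%:R * h * c + 2 = 2 * (2 * (N%:R * h * c) + 1) by ring.
rewrite t2; field; rewrite -?mulrA gt_eqF //; lra.
Qed.

Local Close Scope classical_set_scope.

Theorem theorem4p1 (R : realType) (d N : nat) (h c ccrit : R) :
  (1 <= d)%N -> (1 <= N)%N -> 0 < h <= 1 ->
  psi_largest_root N ccrit -> 1 <= c <= ccrit ->
  (forall (L : R) (f : 'rV[R]_d -> R^o) (xs x0 : 'rV[R]_d),
     0 < L -> convex f -> smooth L f -> minimizer f xs ->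
     let xN := gd L (fun=> h) f x0 N in
     let xsigma := x0 + c *: (xN - x0) in
     f xsigma - f xs <= L * enorm (x0 - xs) ^+ 2 / (4 * N%:R * h * c + 2))
  /\
  (forall L D : R, 0 < L -> 0 < D ->
     exists (f : 'rV[R]_d -> R^o) (xs x0 : 'rV[R]_d),
       [/\ convex f, smooth L f, minimizer f xs & enorm (x0 - xs) = D] /\
       let xN := gd L (fun=> h) f x0 N in
       let xsigma := x0 + c *: (xN - x0) in
       f xsigma - f xs = L * D ^+ 2 / (4 * N%:R * h * c + 2)).
Proof.
move=> d0 N0 hh hcrit hc; split=> [L f xs x0 L0 cf sf hmin | L D L0 D0].
  exact: extrapolated_gd_le hcrit hc L0 cf sf hmin.
case: d d0 => // d _; case/andP: hc => c1 _; case/andP: hh => h0 _.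
exact: extrapolated_gd_tight.
Qed.
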